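(* Let $i\in F$ be a facility, let $l\in T$, $L^i=\{1,\ldots,l\}$ and $S^i\subseteq L^i$. Then the single-level inequality $$\sum_{k\in L^i\setminus S^i}x^i_k+\sum_{k\in S^i}d^i_{kl}\,y^i_k\ \ge\ d^i_{1l}$$ is valid for $X^{STD}$, i.e. it is satisfied by every $(x,s,y)\in X^{STD}$.
   Context: Problem data (uncapacitated three-level lot-sizing and replenishment problem with a distribution structure). $T=\{1,\ldots,|T|\}$ is a finite set of consecutive periods. $F=P\cup W\cup R$ is a finite set of facilities (disjoint union), with $P=\{p\}$ (plant, level 0), $W$ the warehouses (level 1), $R$ the retailers (level 2). Each retailer $r\in R$ has a unique warehouse $\delta_w(r)\in W$; for $w\in W$, $\delta(w)=\{r\in R:\delta_w(r)=w\}$; and $\delta(p)=W$. Each retailer $r$ has demands $d^r_t\ge 0$, $t\in T$. Put $d^p_t=\sum_{r\in R}d^r_t$, $d^w_t=\sum_{r\in\delta(w)}d^r_t$ for $w\in W$, and for $i\in F$, $d^i_{kt}=\sum_{l=k}^{t}d^i_l$ for $1\le k\le t\le |T|$. $X^{STD}$ is the set of all $(x,s,y)$, with $x=(x^i_t)$, $s=(s^i_t)$, $y=(y^i_t)$ indexed by $i\in F$, $t\in T$, and with the convention $s^i_0=0$, satisfying: - $s^i_{t-1}+x^i_t=\sum_{j\in\delta(i)}x^j_t+s^i_t$ for $i\in P\cup W$, $t\in T$; - $s^r_{t-1}+x^r_t=d^r_t+s^r_t$ for $r\in R$, $t\in T$; - $x^i_t\le d^i_{t|T|}\,y^i_t$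 for $i\in F$, $t\in T$; - $x^i_t,s^i_t\ge 0$ and $y^i_t\in\{0,1\}$ for $i\in F$, $t\in T$. *)

(* Defs.v *)
From mathcomp Require Import all_boot all_order all_algebra.
Set Implicit Arguments.
Unset Strict Implicit.
Unset Printing Implicit Defensive.
Import Order.TTheory GRing.Theory Num.Theory.
Local Open Scope ring_scope.

(* The periods 1, ..., n are the elements of 'I_n: t : 'I_n is the period
   with number t.+1. *)

(* F = P \cup W \cup R (disjoint), with P = {p} a singleton; the first summand
   is P \cup W. *)
Notation facility W R := ((unit + W) + R)%type.

Definition warehouse {W R : finType} (w : W) : facility W R := inl (inr w).
Definition retailer {W R : finType} (r : R) : facility W R := inr r.

Definition delta (W R : finType) (delta_w : R -> W) (i : unit + W) :
    {set facility W R} :=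
  match i with
  | inl _ => [set warehouse w | w : W]
  | inr w => [set retailer r | r : R & delta_w r == w]
  end.

Definition demand (K : realFieldType) (n : nat) (W R : finType)
    (delta_w : R -> W) (d : R -> 'I_n -> K) (i : facility W R) (t : 'I_n) : K :=
  match i with
  | inl (inl _) => \sum_(r : R) d r t
  | inl (inr w) => \sum_(r : R | delta_w r == w) d r t
  | inr r => d r t
  end.

(* d^i_{ab}; here a and b are period numbers, counted from 1. *)
Definition cumdemand (K : realFieldType) (n : nat) (W R : finType)
    (delta_w : R -> W) (d : R -> 'I_n -> K) (i : facility W R) (a b : nat) : K :=
  \sum_(t : 'I_n | (a <= t.+1 <= b)%N) demand delta_w d i t.

(* s^i_{t-1}, with s^i_0 = 0. The predecessor ord_pred is cyclic, so the first
   period has to be treated apart. *)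
Definition prev_stock (K : realFieldType) (n : nat) (W R : finType)
    (s : facility W R -> 'I_n -> K) (i : facility W R) (t : 'I_n) : K :=
  if (t : nat) == 0%N then 0 else s i (ord_pred t).

Record XSTD (K : realFieldType) (n : nat) (W R : finType)
    (delta_w : R -> W) (d : R -> 'I_n -> K)
    (x s y : facility W R -> 'I_n -> K) : Prop := {
  XSTD_balance : forall (i : unit + W) (t : 'I_n),
    prev_stock s (inl i) t + x (inl i) t
      = \sum_(j in delta delta_w i) x j t + s (inl i) t;
  XSTD_balance_retailer : forall (r : R) (t : 'I_n),
    prev_stock s (retailer r) t + x (retailer r) t
      = d r t + s (retailer r) t;
  XSTD_setup : forall (i : facility W R) (t : 'I_n),
    x i t <= cumdemand delta_w d i t.+1 n * y i t;
  XSTD_x_ge0 : forall (i : facility W R) (t : 'I_n), 0 <= x i t;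
  XSTD_s_ge0 : forall (i : facility W R) (t : 'I_n), 0 <= s i t;
  XSTD_y_binary : forall (i : facility W R) (t : 'I_n), y i t = 0 \/ y i t = 1
}.

(* Main.v *)
(* Let k0 be the first period of S with a setup (k0 = l + 1 if there is none).
   Before k0 the periods of S have x = 0, so the x-terms of the inequality
   contain the whole production of the periods before k0, which covers the
   demand of these periods because stocks start at 0 and stay nonnegative.
   The term of k0 in the second sum covers the demand from k0 to l. *)
Require Import Defs.
From mathcomp Require Import all_boot all_order all_algebra.
From mathcomp Require Import zify.
Set Implicit Arguments.
Unset Strict Implicit.
Unset Printing Implicit Defensive.
Import Order.TTheory GRing.Theory Num.Theory.
Local Open Scope ring_scope.

Section CumulativeProduction.
Variables (K : realFieldType) (n : nat) (W R : finType).
Implicit Types (x s : facility W R -> 'I_n -> K) (D : 'I_n -> K).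

Lemma big_ord_ltnS (F : 'I_n -> K) (t : 'I_n) :
  \sum_(k < n | (k < t.+1)%N) F k = F t + \sum_(k < n | (k < t)%N) F k.
Proof.
rewrite (bigD1 t) //=; congr (_ + _); apply: eq_bigl => k.
by rewrite ltnS [RHS]ltn_neqAle andbC.
Qed.

(** Telescoping: the stocks between consecutive periods cancel, and the stock before the first
    period is 0. *)
Lemma sum_balance x s i D :
    (forall t, prev_stock s i t + x i t = D t + s i t) ->
  forall t : 'I_n, \sum_(k < n | (k < t.+1)%N) x i k
    = \sum_(k < n | (k < t.+1)%N) D k + s i t.
Proof.
move=> bal [t ltn]; elim: t ltn => [|t IHt] ltn; rewrite !big_ord_ltnS /=.
  rewrite !big_pred0 // !addr0 -bal /prev_stock /=.
  by rewrite add0r.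
(* The index is a successor here, so the cyclic predecessor does not wrap around. *)
have predE : ord_pred (Ordinal ltn) = Ordinal (ltnW ltn).
  by apply: val_inj; rewrite /= modnDr modn_small // ltnW.
rewrite (IHt (ltnW ltn)) addrAC -bal /prev_stock /= predE.
by rewrite [LHS]addrA [LHS]addrC [LHS]addrA.
Qed.

(** Here [m] is a number of periods, so [m = 0] is allowed; this case arises when the first setup in
    [S] is in the first period. *)
Lemma sum_balance_le x s i D m :
    (forall t, prev_stock s i t + x i t = D t + s i t) ->
    (forall t, 0 <= s i t) -> (m <= n)%N ->
  \sum_(k < n | (k < m)%N) D k <= \sum_(k < n | (k < m)%N) x i k.
Proof.
case: m => [|m] bal s_ge0 lemn; first by rewrite !big_pred0.
by rewrite (sum_balance bal (Ordinal lemn)) lerDl.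
Qed.

End CumulativeProduction.

Section Covering.
Variables (K : realFieldType) (n : nat) (W R : finType).
Variables (delta_w : R -> W) (d : R -> 'I_n -> K).
Implicit Types (i : facility W R) (x s y : facility W R -> 'I_n -> K).

Lemma big_delta_plant (F : facility W R -> K) u :
  \sum_(j in delta delta_w (inl u)) F j = \sum_(w : W) F (warehouse w).
Proof. by rewrite big_imset //= => w w' _ _ []. Qed.

Lemma big_delta_warehouse (F : facility W R -> K) w :
  \sum_(j in delta delta_w (inr w)) F j
    = \sum_(r : R | delta_w r == w) F (retailer r).
Proof.
rewrite big_imset /=; last by move=> r r' _ _ [].
by apply: eq_bigl => r; rewrite inE.
Qed.

(** At the plant, the retailers are partitioned by their warehouse. *)
Lemma demand_delta (i : unit + W) t :
  \sum_(j in delta delta_w i) demand delta_w d j t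
    = demand delta_w d (inl i) t.
Proof.
case: i => [u|w]; last by rewrite big_delta_warehouse.
by rewrite big_delta_plant /= [RHS](partition_big delta_w xpredT).
Qed.

Lemma cumdemand_delta (i : unit + W) a b :
  \sum_(j in delta delta_w i) cumdemand delta_w d j a b
    = cumdemand delta_w d (inl i) a b.
Proof. by rewrite exchange_big; apply: eq_bigr => t _; apply: demand_delta. Qed.

Lemma cumdemand_cat i a b c : (a <= b.+1)%N -> (b <= c)%N ->
  cumdemand delta_w d i a b + cumdemand delta_w d i b.+1 c
    = cumdemand delta_w d i a c.
Proof.
move=> leab lebc; rewrite /cumdemand [RHS](bigID (fun t : 'I_n => t < b)%N) /=.
by congr (_ + _); apply: eq_bigl => t; lia.
Qed.

(** Induction up the levels, from retailers to plant: production at a facility covers the production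
    of its successors, hence their demands, which add up to its own. *)
Lemma cumdemand_le_production x s y i m : XSTD delta_w d x s y -> (m <= n)%N ->
  cumdemand delta_w d i 1 m <= \sum_(k < n | (k < m)%N) x i k.
Proof.
move=> X lemn.
have retailer_le r : cumdemand delta_w d (retailer r) 1 m
    <= \sum_(k < n | (k < m)%N) x (retailer r) k.
  (* The range [1 <= t.+1 <= m] of [cumdemand] reduces to [t < m] by computation. *)
  apply: sum_balance_le lemn; last exact: XSTD_s_ge0 X _.
  exact: XSTD_balance_retailer X r.
have step j : (forall f, f \in delta delta_w j ->
      cumdemand delta_w d f 1 m <= \sum_(k < n | (k < m)%N) x f k) ->
    cumdemand delta_w d (inl j) 1 m <= \sum_(k < n | (k < m)%N) x (inl j) k.
  move=> succ_le; rewrite -cumdemand_delta.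
  apply: le_trans (sum_balance_le (XSTD_balance X j) (XSTD_s_ge0 X _) lemn).
  by rewrite [leRHS]exchange_big; apply: ler_sum.
have warehouse_le w : cumdemand delta_w d (warehouse w) 1 m
    <= \sum_(k < n | (k < m)%N) x (warehouse w) k.
  by apply: step => _ /imsetP[r _ ->].
case: i => [[u|w]|r]; [|exact: warehouse_le|exact: retailer_le].
by apply: step => _ /imsetP[w _ ->].
Qed.

Hypothesis d_ge0 : forall (r : R) (t : 'I_n), 0 <= d r t.

Lemma cumdemand_ge0 i a b : 0 <= cumdemand delta_w d i a b.
Proof.
by apply: sumr_ge0 => t _; case: i => [[u|w]|r] //=; apply: sumr_ge0.
Qed.

Lemma setup_term_ge0 x s y i a b k : XSTD delta_w d x s y ->
  0 <= cumdemand delta_w d i a b * y i k.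
Proof.
move=> X; apply: mulr_ge0; first exact: cumdemand_ge0.
by case: (XSTD_y_binary X i k) => ->.
Qed.

Lemma no_setup_production0 x s y i t : XSTD delta_w d x s y ->
  y i t = 0 -> x i t = 0.
Proof.
move=> X y0; apply/le_anti; rewrite (XSTD_x_ge0 X) andbT.
by have := XSTD_setup X i t; rewrite y0 mulr0.
Qed.

(** Periods of [S] among the first [m] have no setup, hence no production, so leaving them out loses
    nothing. *)
Lemma production_outside_ge x s y i (l : 'I_n) (S : {set 'I_n}) m :
    XSTD delta_w d x s y -> (m <= l.+1)%N ->
    (forall k, k \in S -> (k < m)%N -> y i k = 0) ->
  cumdemand delta_w d i 1 m
    <= \sum_(k in [set k : 'I_n | (k <= l)%N] :\: S) x i k.
Proof.
move=> X leml y0.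
apply: le_trans (cumdemand_le_production i X (leq_trans leml (ltn_ord l))) _.
rewrite (bigID (mem S)) /= big1 ?add0r => [|k /andP[ltkm kS]]; last first.
  by apply: no_setup_production0 X _; apply: y0.
(* Both sums now range over all periods, with zeros filled in, and are compared term by term. *)
rewrite big_mkcond [leRHS]big_mkcond; apply: ler_sum => k _; rewrite !inE.
have x_ge0 := XSTD_x_ge0 X i k.
case: (k \in S); first by rewrite andbF.
rewrite andbT /=; case: ltnP => [ltkm|_]; last by case: ifP.
by rewrite -ltnS (leq_trans ltkm leml).
Qed.

End Covering.

Theorem proposition1 (K : realFieldType) (n : nat) (W R : finType)
    (delta_w : R -> W) (d : R -> 'I_n -> K)
    (d_ge0 : forall (r : R) (t : 'I_n), 0 <= d r t)
    (i : facility W R) (l : 'I_n) (L S : {set 'I_n})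
    (L_def : L = [set k : 'I_n | (k <= l)%N])
    (S_sub : S \subset L)
    (x s y : facility W R -> 'I_n -> K)
    (xsy : XSTD delta_w d x s y) :
  \sum_(k in L :\: S) x i k
    + \sum_(k in S) cumdemand delta_w d i k.+1 l.+1 * y i k
  >= cumdemand delta_w d i 1 l.+1.
Proof.
rewrite L_def in S_sub *.
have term_ge0 (k : 'I_n) : 0 <= cumdemand delta_w d i k.+1 l.+1 * y i k.
  exact: (setup_term_ge0 d_ge0 _ _ _ _ xsy).
case: (pickP [pred k in S | y i k == 1]) => [k1 k1P|noS]; last first.
  (* No setup in [S]: the x-terms alone cover the demand, with [m = l.+1]. *)
  rewrite -[leLHS]addr0; apply: lerD; last exact: sumr_ge0.
  apply: (production_outside_ge xsy (leqnn _)) => // k kS _.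
  case: (XSTD_y_binary xsy i k) => // yk.
  by have := noS k; rewrite /= kS yk eqxx.
case: (arg_minnP (fun k : 'I_n => k : nat) k1P) => k0 /andP[k0S /eqP yk0] k0_min.
have lek0l : (k0 <= l)%N by have := subsetP S_sub _ k0S; rewrite inE.
(* The period [k0] has number [k0.+1], so the periods before it are those numbered 1 to [k0]. *)
rewrite -(@cumdemand_cat _ _ _ _ _ _ _ 1 k0) ?(leqW lek0l) //; apply: lerD.
  apply: (production_outside_ge xsy (leqW lek0l)) => // k kS ltkk0.
  case: (XSTD_y_binary xsy i k) => // yk.
  by have := k0_min k; rewrite /= kS yk eqxx leqNgt ltkk0 => /(_ isT).
(* As [y i k0 = 1], the term of [k0] is exactly the remaining demand; the other terms are
   nonnegative. *)
by rewrite (bigD1 k0) //= yk0 mulr1 lerDl; apply: sumr_ge0.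
Qed.
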